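(* Let $\sigma$ be a relational signature. Let $\langle\cdot,\cdot\rangle_{\Gamma}\colon\mathrm{Fin}(\sigma)\to\mathcal{M}_{\Gamma}(\mathrm{FO}(\sigma))$ be the $\mathbf{\Gamma}$-valued Stone pairing $A\mapsto\langle\cdot,A\rangle_{\Gamma}$, and let $\langle\cdot,\cdot\rangle_{I}\colon\mathrm{Fin}(\sigma)\to\mathcal{M}_{I}(\mathrm{FO}(\sigma))$ be the classical Stone pairing $A\mapsto\langle\cdot,A\rangle_{I}$. Then for every $A\in\mathrm{Fin}(\sigma)$, $$\gamma^{\#}\big(\langle\cdot,A\rangle_{\Gamma}\big)=\langle\cdot,A\rangle_{I}\qquad\text{and}\qquad\iota^{\#}\big(\langle\cdot,A\rangle_{I}\big)=\langle\cdot,A\rangle_{\Gamma}.$$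
   Context: The Priestley space $\mathbf{\Gamma}$. Its underlying set consists of formal symbols $\{r^{-}\mid r\in(0,1]\}\cup\{q^{\circ}\mid q\in[0,1]\cap\mathbb{Q}\}$, totally ordered by: $r^{-}<s^{-}$ iff $r<s$; $p^{\circ}<q^{\circ}$ iff $p<q$; $r^{-}<q^{\circ}$ iff $r\le q$; $q^{\circ}<r^{-}$ iff $q<r$. Two partial operations on $\mathbf{\Gamma}$, $x-y$ and $x\sim y$, are defined exactly when $y\le x$. The first is: $r^{\circ}-s^{\circ}=(r-s)^{\circ}$; $r^{-}-s^{\circ}=(r-s)^{-}$; and both $r^{\circ}-s^{-}$ and $r^{-}-s^{-}$ equal $(r-s)^{\circ}$ if $r-s\in\mathbb{Q}$ and $(r-s)^{-}$ otherwise. The second is $x\sim y=\bigvee\{x-q^{\circ}\mid q\in\mathbb{Q}\cap[0,1],\ y<q^{\circ}\le x\}$. A partial addition $x+y$ is defined when $x\le1^{\circ}-y$, by $r^{\circ}+s^{\circ}=(r+s)^{\circ}$ and $r^{-}+s^{\circ}=r^{\circ}+s^{-}=r^{-}+s^{-}=(r+s)^{-}$; iterated sums are written $\sum$ (the empty sum is $0^\circ$). A $\mathbf{\Gamma}$-valued measure on a bounded distributive lattice $D$ is a function $\mu\colon D\to\mathbf{\Gamma}$ such that (1) $\mu$ is monotone; (2) $\mu(0)=0^{\circ}$ and $\mu(1)=1^{\circ}$; (3) for all $a,b\in D$, $\mu(a)\sim\mu(a\wedge b)\le\mu(a\vee b)-\mu(b)$ and $\mu(a)-\mu(a\wedge b)\ge\mu(a\vee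 b)\sim\mu(b)$. $\mathcal{M}_{\Gamma}(D)$ is the set of all such measures. $\mathcal{M}_{I}(D)$ is the set of monotone functions $m\colon D\to[0,1]$ with $m(0)=0$, $m(1)=1$ and $m(a)+m(b)=m(a\vee b)+m(a\wedge b)$ for all $a,b\in D$. The map $\gamma\colon\mathbf{\Gamma}\to[0,1]$ sends $r^{-}$ and $r^{\circ}$ to $r$; $\iota\colon[0,1]\to\mathbf{\Gamma}$ sends $r$ to $r^{\circ}$ if $r\in\mathbb{Q}$ and to $r^{-}$ otherwise. Put $\gamma^{\#}(\mu)=\gamma\circ\mu$ and $\iota^{\#}(m)=\iota\circ m$; these are well-defined maps $\mathcal{M}_{\Gamma}(D)\to\mathcal{M}_{I}(D)$ and $\mathcal{M}_{I}(D)\to\mathcal{M}_{\Gamma}(D)$. Fix distinct variables $v_1,v_2,\dots$. $\mathrm{FO}_n(\sigma)$ is the Boolean algebra of first-order $\sigma$-formulas with free variables among $v_1,\dots,v_n$ modulo logical equivalence, and $\mathrm{FO}(\sigma)=\bigcup_n\mathrm{FO}_n(\sigma)$. $\mathrm{Fin}(\sigma)$ is the set of isomorphism classes of finite (non-empty) $\sigma$-structures. $\mathrm{Typ}_n(\sigma)$ is the set of classes, under elementary equivalence, of pairs $(B,\beta)$ with $B$ a $\sigma$-structure and $\beta\colon\{v_1,\dots,v_n\}\to B$ (two pairs being equivalent if they satisfy the same formulas of $\mathrm{FO}_n(\sigma)$); $[\![\varphi]\!]_n\subseteq\mathrm{Typ}_n(\sigma)$ is the set of classes of pairs satisfying $\varphi$.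 Classical Stone pairing: for $\varphi$ with free variables among $v_1,\dots,v_n$, $\langle\varphi,A\rangle_{I}=|\{\overline{a}\in A^n\mid A\models\varphi(\overline{a})\}|/|A|^n$. $\mathbf{\Gamma}$-valued Stone pairing: for $A\in\mathrm{Fin}(\sigma)$ and $E\in\mathrm{Typ}_n(\sigma)$ let $f_n^A(E)=\sum_{\alpha\colon\{v_1,\dots,v_n\}\to A,\ (A,\alpha)\in E}\left(1/|A|^n\right)^{\circ}$, which is non-zero (i.e. $\neq0^{\circ}$) for only finitely many $E$. Let $\mu_n^A\colon\mathrm{FO}_n(\sigma)\to\mathbf{\Gamma}$, $\mu_n^A(\varphi)=\sum_{E\in[\![\varphi]\!]_n,\ f_n^A(E)\ne0^{\circ}}f_n^A(E)$. The $\mu_n^A$ are measures compatible under restriction, and $\langle\cdot,A\rangle_{\Gamma}\colon\mathrm{FO}(\sigma)\to\mathbf{\Gamma}$ is the unique measure whose restriction to $\mathrm{FO}_n(\sigma)$ is $\mu_n^A$ for every $n$. *)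

(* Defs.v *)
From HB Require Import structures.
From mathcomp Require Import all_boot all_order all_algebra.
From mathcomp Require Import ring lra interval_inference generic_quotient.
From mathcomp Require Import all_classical all_reals.

Set Implicit Arguments.
Unset Strict Implicit.
Unset Printing Implicit Defensive.

Import Order.TTheory GRing.Theory Num.Theory.

Local Open Scope classical_set_scope.
Local Open Scope ring_scope.
Local Open Scope quotient_scope.

Section GammaSpace.
Variable R : realType.

(* [Minus r] stands for r^- and [Circ q] for q°. *)
Inductive symbol := Minus of R | Circ of R.

Definition symbol_code (x : symbol) : bool * R :=
  match x with Minus r => (true, r) | Circ r => (false, r) end.

Definition symbol_decode (c : bool * R) : symbol :=
  if c.1 then Minus c.2 else Circ c.2.

Lemma symbol_codeK : cancel symbol_code symbol_decode.
Proof. by case. Qed.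

HB.instance Definition _ := Choice.copy symbol (can_type symbol_codeK).

Definition in_Gamma (x : symbol) : bool :=
  match x with
  | Minus r => 0 < r <= 1
  | Circ q => (0 <= q <= 1) && `[< rational q >]
  end.

Record Gamma := MkGamma { symbol_of : symbol; _ : in_Gamma symbol_of }.

HB.instance Definition _ := [isSub for symbol_of].
HB.instance Definition _ := [Choice of Gamma by <:].

Definition symbol_lt (x y : symbol) : bool :=
  match x, y with
  | Minus r, Minus s => r < s
  | Circ p, Circ q => p < q
  | Minus r, Circ q => r <= q
  | Circ q, Minus r => q < r
  end.

Definition Gamma_lt (x y : Gamma) : bool := symbol_lt (val x) (val y).
Definition Gamma_le (x y : Gamma) : bool := (x == y) || Gamma_lt x y.

Fact Gamma_lt_irr : irreflexive Gamma_lt.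
Proof. by case=> [[r|r] ?]; rewrite /Gamma_lt /= ltxx. Qed.

Fact Gamma_lt_trans : transitive Gamma_lt.
Proof.
case=> [[y|y] ?] [[x|x] ?] [[z|z] ?]; rewrite /Gamma_lt /=; lra.
Qed.

Fact Gamma_display : Order.disp_t. Proof. exact: Order.Disp tt tt. Qed.

HB.instance Definition _ := Order.LtLe_isPOrder.Build Gamma_display Gamma
  (fun _ _ => erefl) Gamma_lt_irr Gamma_lt_trans.

Lemma Gamma_leE (x y : Gamma) :
  (x <= y)%O = (val x == val y) || symbol_lt (val x) (val y).
Proof. by []. Qed.

Fact Gamma_le_total : total (<=%O : rel Gamma).
Proof.
move=> [[x|x] xP] [[y|y] yP]; rewrite !Gamma_leE /=.
- by case: (ltgtP x y) => [||->]; rewrite ?orbT ?eqxx.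
- by case: (lerP x y) => /=; rewrite ?orbT.
- by case: (lerP y x) => /=; rewrite ?orbT.
- by case: (ltgtP x y) => [||->]; rewrite ?orbT ?eqxx.
Qed.

Lemma Gamma_le_symbol (x y : Gamma) : (x <= y)%O =
  match val x, val y with
  | Minus r, Minus s | Circ r, Circ s | Minus r, Circ s => r <= s
  | Circ q, Minus r => q < r
  end.
Proof.
rewrite Gamma_leE -(inj_eq (can_inj symbol_codeK)).
by case: (val x) (val y) => r [] s /=; rewrite ?xpair_eqE //= -le_eqVlt.
Qed.

HB.instance Definition _ :=
  Order.POrder_isTotal.Build Gamma_display Gamma Gamma_le_total.

Fact in_Gamma0 : in_Gamma (Circ 0).
Proof. by rewrite /= lexx ler01; apply/asboolP; exists 0; rewrite ?rmorph0. Qed.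

Fact in_Gamma1 : in_Gamma (Circ 1).
Proof. by rewrite /= lexx ler01; apply/asboolP; exists 1; rewrite ?rmorph1. Qed.

Definition g0 : Gamma := MkGamma in_Gamma0.
Definition g1 : Gamma := MkGamma in_Gamma1.

(* r^- and q° for real arguments; outside the ranges of the definition of
   Gamma the value is a meaningless 0°. *)
Definition gminus (r : R) : Gamma := insubd g0 (Minus r).
Definition gcirc (q : R) : Gamma := insubd g0 (Circ q).

(* Partial operations are totalised; the subtractions are 0° outside of
   their domain y <= x. *)
Definition gsub (x y : Gamma) : Gamma :=
  if (y <= x)%O then
    match val x, val y with
    | Circ r, Circ s => gcirc (r - s)
    | Minus r, Circ s => gminus (r - s)
    | Circ r, Minus s | Minus r, Minus s =>
        if `[< rational (r - s) >] then gcirc (r - s) else gminus (r - s)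
    end
  else g0.

(* The set is empty, and hence its supremum 0°, unless y <= x. *)
Definition gsim (x y : Gamma) : Gamma :=
  supremum g0 [set gsub x (gcirc q) | q in
    [set q : R | [/\ rational q, 0 <= q <= 1, (y < gcirc q)%O
                   & (gcirc q <= x)%O]]].

(* Outside of the domain x <= 1° - y the value is 1°, which makes gadd a
   commutative monoid law. The sums of weights below never leave the domain:
   see big_gcirc and stone_Gamma_nE. *)
Definition gadd (x y : Gamma) : Gamma :=
  if (x <= gsub g1 y)%O then
    match val x, val y with
    | Circ r, Circ s => gcirc (r + s)
    | Minus r, Circ s | Circ r, Minus s | Minus r, Minus s => gminus (r + s)
    end
  else g1.

Definition greal (x : Gamma) : R :=
  match val x with Minus r => r | Circ r => r end.

Lemma greal_ge0 x : 0 <= greal x.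
Proof.
by case: x => [[r|r] h]; rewrite /greal /=; [case/andP: h => /ltW|case/andP: h => /andP[]].
Qed.

Lemma greal_le1 x : greal x <= 1.
Proof.
by case: x => [[r|r] h]; rewrite /greal /=; [case/andP: h|case/andP: h => /andP[]].
Qed.

Definition gamma_map (x : Gamma) : {i01 R} := Itv01 (greal_ge0 x) (greal_le1 x).

Definition iota_map (r : {i01 R}) : Gamma :=
  if `[< rational r%:num >] then gcirc r%:num else gminus r%:num.

Lemma val_gminus r : 0 < r <= 1 -> val (gminus r) = Minus r.
Proof. by move=> h; rewrite /gminus val_insubd /= h. Qed.

Lemma val_gcirc q : rational q -> 0 <= q <= 1 -> val (gcirc q) = Circ q.
Proof. by move=> /asboolP qQ h; rewrite /gcirc val_insubd /= h qQ. Qed.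

Lemma Gamma_ltE (x y : Gamma) : (x < y)%O = symbol_lt (val x) (val y).
Proof. by []. Qed.

Definition ismin (x : symbol) := (symbol_code x).1.

Lemma greal_val x : greal x = (symbol_code (val x)).2.
Proof. by case: x => [[]]. Qed.

Lemma Gamma_valP x : val x = if ismin (val x) then Minus (greal x)
   else Circ (greal x).
Proof. by case: x => [[]]. Qed.

Lemma rationalB (p q : R) : rational p -> rational q -> rational (p - q).
Proof. by move=> [a _ <-] [b _ <-]; exists (a - b); rewrite ?rmorphB. Qed.
Lemma rationalD (p q : R) : rational p -> rational q -> rational (p + q).
Proof. by move=> [a _ <-] [b _ <-]; exists (a + b); rewrite ?rmorphD. Qed.
Lemma rational1 : rational (1 : R).
Proof. by exists 1; rewrite ?rmorph1. Qed.
Lemma rational0 : rational (0 : R).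
Proof. by exists 0; rewrite ?rmorph0. Qed.

Lemma in_Gamma_circ (x : Gamma) r : val x = Circ r -> 0 <= r <= 1 /\ rational r.
Proof. by case: x => [[s|s] /= h] [] // <-; case/andP: h => -> /asboolP. Qed.

Lemma in_Gamma_minus (x : Gamma) r : val x = Minus r -> 0 < r <= 1.
Proof. by case: x => [[s|s] /= h] [] // <-. Qed.

Lemma le_greal (x y : Gamma) : (x <= y)%O -> greal x <= greal y.
Proof.
case: x y => [[x|x] ?] [[y|y] ?];
  rewrite Gamma_le_symbol /greal /=; lra.
Qed.

Definition grat (r : R) := if `[< rational r >] then gcirc r else gminus r.

Lemma greal_gcirc r : rational r -> 0 <= r <= 1 -> greal (gcirc r) = r.
Proof. by move=> rQ r01; rewrite /greal val_gcirc. Qed.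

Lemma greal_gminus r : 0 < r <= 1 -> greal (gminus r) = r.
Proof. by move=> r01; rewrite /greal val_gminus. Qed.

Lemma irrational_gt0 (r : R) : ~ rational r -> 0 <= r -> 0 < r.
Proof.
move=> rQ r0; rewrite lt_neqAle r0 andbT; apply/eqP => r0E.
by apply: rQ; rewrite -r0E; exact: rational0.
Qed.

Lemma greal_grat r : 0 <= r <= 1 -> greal (grat r) = r.
Proof.
move=> /andP[r0 r1]; rewrite /grat; case: asboolP => rQ.
  by rewrite greal_gcirc ?r0.
by rewrite greal_gminus// r1 irrational_gt0.
Qed.

Lemma le_grat x : (x <= grat (greal x))%O.
Proof.
rewrite Gamma_le_symbol /grat greal_val.
case xE : (val x) => [r|r] /=.
  case: asboolP => rQ; first by rewrite val_gcirc//; move: (in_Gamma_minus xE); lra.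
  by rewrite val_gminus ?lexx//; exact: in_Gamma_minus xE.
by case: (in_Gamma_circ xE) => r01 /[dup] /asboolP -> rQ; rewrite val_gcirc.
Qed.

Lemma gsubE (x y : Gamma) : (y <= x)%O -> val (gsub x y) =
  match val x, val y with
    | Circ r, Circ s => Circ (r - s)
    | Minus r, Circ s => Minus (r - s)
    | Circ r, Minus s | Minus r, Minus s =>
       if `[< rational (r - s) >] then Circ (r - s) else Minus (r - s)
    end.
Proof.
move=> yx; rewrite /gsub yx; move: yx.
rewrite Gamma_le_symbol.
case xE : (val x) => [r|r]; case yE : (val y) => [s|s] rs.
- move: (in_Gamma_minus xE) (in_Gamma_minus yE) => ? ?.
  have rs0 : 0 <= r - s by lra.
  case: asboolP => rQ; first by rewrite val_gcirc//; lra.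
  by rewrite val_gminus// irrational_gt0//=; lra.
- move: (in_Gamma_minus xE) (in_Gamma_circ yE) => ? [? ?].
  by rewrite val_gminus//; lra.
- move: (in_Gamma_circ xE) (in_Gamma_minus yE) => [? ?] ?.
  have rs0 : 0 <= r - s by lra.
  case: asboolP => rQ; first by rewrite val_gcirc//; lra.
  by rewrite val_gminus// irrational_gt0//=; lra.
- move: (in_Gamma_circ xE) (in_Gamma_circ yE) => [? ?] [? ?].
  rewrite val_gcirc//; first exact: rationalB.
  by lra.
Qed.

Lemma greal_gsub x y : (y <= x)%O -> greal (gsub x y) = greal x - greal y.
Proof.
move=> yx; rewrite greal_val gsubE// !greal_val.
by case: (val x) (val y) => r [] s //=; case: ifP.
Qed.

Lemma greal_iota (r : {i01 R}) : greal (iota_map r) = r%:num.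
Proof. by apply: greal_grat; apply/andP; split. Qed.

Lemma supremum_eq (A : set Gamma) z :
  A !=set0 -> supremums A z -> supremum g0 A = z.
Proof.
move=> /set0P A0 Az; rewrite /supremum (negbTE A0).
by case: xgetP => [y _ Ay|/(_ z)//]; exact: (is_subset1_supremums Ay Az).
Qed.

Lemma greal_gsim x y : (y <= x)%O -> greal (gsim x y) = greal x - greal y.
Proof.
move=> yx; rewrite /gsim; set Q := [set q : R | _]; set A := [set _ | _ in _].
have Qlt q : rational q -> greal y < q -> q < greal x -> Q q.
  move=> qQ yq qx.
  have q01 : 0 <= q <= 1 by have := greal_ge0 y; have := greal_le1 x; lra.
  split => //; first by rewrite ltNge; apply/negP => /le_greal; rewrite greal_gcirc// leNgt yq.
  by rewrite leNgt; apply/negP => /ltW/le_greal; rewrite greal_gcirc// leNgt qx.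
have Qle q : Q q -> greal y <= q <= greal x.
  move=> [qQ q01 /ltW /le_greal yq /le_greal qx].
  by move: yq qx; rewrite greal_gcirc// => -> ->.
have gsubq q : Q q -> greal (gsub x (gcirc q)) = greal x - q.
  by move=> [qQ q01 _ qx]; rewrite greal_gsub// greal_gcirc.
have := le_greal yx; rewrite le_eqVlt => /predU1P[xy|xy].
  have Qx q : Q q -> q = greal x by move=> /Qle; rewrite xy; lra.
  have [->|/set0P A0] := eqVneq A set0.
    by rewrite supremum0 /greal/= -/(greal _) -/(greal _) xy subrr.
  case: A0 => a [q Qq _].
  have AE : A = [set gsub x (gcirc q)].
    apply/seteqP; split => [_ [p Qp <-]|_ ->]; last by exists q.
    by rewrite (Qx _ Qp) (Qx _ Qq).
  by rewrite AE supremum1 gsubq// (Qx _ Qq) xy.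
have A0 : A !=set0.
  have [q] := rat_in_itvoo xy; rewrite in_itv /= => /andP[yq qx].
  by exists (gsub x (gcirc (ratr q))), (ratr q) => //; apply: Qlt => //; exists q.
have d01 : 0 < greal x - greal y <= 1.
  by have := greal_ge0 y; have := greal_le1 x; lra.
have [Qy|nQy] := pselect (Q (greal y)).
  rewrite (@supremum_eq _ (gsub x (gcirc (greal y)))) ?gsubq//.
  split; last by move=> z; apply; exists (greal y).
  move=> _ [q Qq <-].
  have [->//|qy] := eqVneq q (greal y).
  rewrite leNgt; apply/negP => /ltW /le_greal; rewrite !gsubq//.
  by move: (Qle _ Qq); lra.
rewrite (@supremum_eq _ (gminus (greal x - greal y))) ?greal_gminus//.
split=> [_ [q Qq <-]|b bA].
  have qy : q != greal y by apply/eqP => qy; apply: nQy; rewrite -qy.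
  rewrite leNgt; apply/negP => /ltW /le_greal; rewrite greal_gminus// gsubq//.
  by move: (Qle _ Qq); lra.
rewrite leNgt; apply/negP => bd.
have {bd} bd : greal b < greal x - greal y.
  by move: bd; rewrite Gamma_ltE val_gminus// (greal_val b); case: (val b).
have : greal y < greal x - greal b by lra.
move=> /rat_in_itvoo[q]; rewrite in_itv /= => /andP[yq qx].
have Qq : Q (ratr q).
  by apply: Qlt; [exists q|by []|have := greal_ge0 b; lra].
have /le_greal := bA _ (ex_intro2 _ _ _ Qq erefl).
by rewrite gsubq//; lra.
Qed.

Lemma greal_g0 : greal g0 = 0. Proof. by []. Qed.
Lemma greal_g1 : greal g1 = 1. Proof. by []. Qed.

Lemma greal_eq0 x : greal x = 0 -> x = g0.
Proof.
case: x => [[r|r] h]; rewrite /greal /= => r0; apply/val_inj => /=.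
  by move: h; rewrite r0 /= ltxx.
by rewrite r0.
Qed.

Lemma le_g1 x : (x <= g1)%O.
Proof. by rewrite Gamma_le_symbol; move: (greal_le1 x); rewrite greal_val; case: (val x). Qed.

Definition mkval (b : bool) (r : R) := if b then Minus r else Circ r.

Lemma gaddE x y : val (gadd x y) =
  if greal x + greal y <= 1 then
    mkval (ismin (val x) || ismin (val y)) (greal x + greal y)
  else Circ 1.
Proof.
have defE : (x <= gsub g1 y)%O = (greal x + greal y <= 1).
  rewrite Gamma_le_symbol gsubE ?le_g1// !greal_val [val g1]/=.
  case yE : (val y) => [s|s]; case xE : (val x) => [r|r] /=.
  - by case: asboolP => _; apply/idP/idP; lra.
  - case: asboolP => [_|sQ]; first by apply/idP/idP; lra.
    rewrite lt_neqAle (_ : r != 1 - s) /=; first by apply/idP/idP; lra.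
    by apply/eqP => rs; apply: sQ; rewrite -rs; exact: (in_Gamma_circ xE).2.
  - by apply/idP/idP; lra.
  - by apply/idP/idP; lra.
rewrite /gadd defE !greal_val; case: ifPn => //.
case xE : (val x) => [r|r]; case yE : (val y) => [s|s] /= rs.
- move: (in_Gamma_minus xE) (in_Gamma_minus yE) => ? ?.
  by rewrite val_gminus//; lra.
- move: (in_Gamma_minus xE) (in_Gamma_circ yE) => ? [? ?].
  by rewrite val_gminus//; lra.
- move: (in_Gamma_circ xE) (in_Gamma_minus yE) => [? ?] ?.
  by rewrite val_gminus//; lra.
- move: (in_Gamma_circ xE) (in_Gamma_circ yE) => [? ?] [? ?].
  by rewrite val_gcirc//; [exact: rationalD|lra].
Qed.

Lemma greal_gadd x y : greal (gadd x y) = Num.min (greal x + greal y) 1.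
Proof.
rewrite greal_val gaddE /Num.min /mkval.
by case: (ltgtP (greal x + greal y) 1) => //= h; case: ifP.
Qed.

Lemma ismin_gadd x y : ismin (val (gadd x y)) =
  (greal x + greal y <= 1) && (ismin (val x) || ismin (val y)).
Proof. by rewrite gaddE /mkval; case: ifP => // _; case: ifP. Qed.

Lemma Gamma_ext x y : greal x = greal y -> ismin (val x) = ismin (val y) -> x = y.
Proof.
move=> rE mE; apply/val_inj.
by rewrite [LHS]Gamma_valP [RHS]Gamma_valP mE rE.
Qed.

Lemma gaddC : commutative gadd.
Proof.
by move=> x y; apply/val_inj; rewrite /= !gaddE addrC orbC.
Qed.

Lemma add0g : left_id g0 gadd.
Proof.
move=> x; apply/val_inj; rewrite /= gaddE greal_g0 add0r greal_le1 /mkval /=.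
by rewrite [RHS]Gamma_valP.
Qed.

Lemma gaddA : associative gadd.
Proof.
move=> x y z; have := greal_ge0 x; have := greal_ge0 y; have := greal_ge0 z.
move=> z0 y0 x0; apply: Gamma_ext.
  rewrite !greal_gadd /Num.min; do ! case: ifPn; lra.
rewrite !ismin_gadd !greal_gadd /Num.min.
have m0 u : ismin (val u) -> 0 < greal u.
  by rewrite greal_val; case uE : (val u) => [r|r] //= _; case/andP: (in_Gamma_minus uE).
move: (m0 x) (m0 y) (m0 z) => {m0}.
move: (ismin (val x)) (ismin (val y)) (ismin (val z)) => a b c.
move: (greal x) (greal y) (greal z) x0 y0 z0 => X Y Z X0 Y0 Z0 aX bY cZ.
case: (ltgtP (Y + Z) 1) => YZ; case: (ltgtP (X + Y) 1) => XY /=;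
case: a aX => [/(_ isT) aX|_]; case: b bY => [/(_ isT) bY|_];
case: c cZ => [/(_ isT) cZ|_] /=; rewrite ?andbT ?andbF ?addrA //;
by apply/idP/idP; lra.
Qed.

HB.instance Definition _ := Monoid.isComLaw.Build Gamma g0 gadd gaddA gaddC add0g.

End GammaSpace.

Arguments Gamma_lt {R} x y.
Arguments Gamma_le {R} x y.
Arguments g0 {R}.
Arguments g1 {R}.

Section Measures.
Context (R : realType) {d : Order.disp_t} (D : tbDistrLatticeType d).

Definition is_Gamma_measure (mu : D -> Gamma R) : Prop :=
  [/\ {homo mu : a b / (a <= b)%O},
      mu \bot%O = g0,
      mu \top%O = g1 &
      forall a b : D,
        (gsim (mu a) (mu (a `&` b)%O) <= gsub (mu (a `|` b)%O) (mu b))%O /\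
        (gsim (mu (a `|` b)%O) (mu b) <= gsub (mu a) (mu (a `&` b)%O))%O].

Definition is_I_measure (m : D -> {i01 R}) : Prop :=
  [/\ {homo m : a b / (a <= b)%O >-> a%:num <= b%:num},
      (m \bot%O)%:num = 0,
      (m \top%O)%:num = 1 &
      forall a b : D,
        (m a)%:num + (m b)%:num = (m (a `|` b)%O)%:num + (m (a `&` b)%O)%:num].

Record Gamma_measure := GammaMeasure {
  Gamma_measure_fun :> D -> Gamma R;
  Gamma_measureP : is_Gamma_measure Gamma_measure_fun }.

Record I_measure := IMeasure {
  I_measure_fun :> D -> {i01 R};
  I_measureP : is_I_measure I_measure_fun }.

Lemma Gamma_measure_ext (mu nu : Gamma_measure) : mu =1 nu -> mu = nu.
Proof.
case: mu nu => [mu muP] [nu nuP] /= /funext munu; rewrite munu in muP *.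
by congr GammaMeasure; exact: Prop_irrelevance.
Qed.

Lemma I_measure_ext (m n : I_measure) : m =1 n -> m = n.
Proof.
case: m n => [m mP] [n nP] /= /funext mn; rewrite mn in mP *.
by congr IMeasure; exact: Prop_irrelevance.
Qed.

Lemma gamma_sharp_subproof (mu : Gamma_measure) :
  is_I_measure (@gamma_map R \o mu).
Proof.
case: (Gamma_measureP mu) => mumon mu0 mu1 mu3; split => /=.
- by move=> a b /mumon /le_greal.
- by rewrite mu0.
- by rewrite mu1.
- move=> a b; case: (mu3 a b) => /le_greal + /le_greal.
  have h1 : (mu (a `&` b) <= mu a)%O by apply: mumon; exact: leIl.
  have h2 : (mu b <= mu (a `|` b))%O by apply: mumon; exact: leUr.
  by rewrite !greal_gsub// !greal_gsim//; lra.
Qed.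

Definition gamma_sharp (mu : Gamma_measure) : I_measure :=
  IMeasure (gamma_sharp_subproof mu).

Lemma grat_le (r s : R) : 0 <= r <= 1 -> 0 <= s <= 1 -> r <= s ->
  (grat r <= grat s)%O.
Proof.
move=> r01 s01; rewrite le_eqVlt => /predU1P[->//|rs].
rewrite leNgt; apply/negP => /ltW/le_greal.
by rewrite !greal_grat//; lra.
Qed.

Lemma val_grat (r : R) : 0 <= r <= 1 ->
  val (grat r) = if `[< rational r >] then Circ r else Minus r.
Proof.
move=> r01; rewrite /grat; case: asboolP => rQ; first by rewrite val_gcirc.
by rewrite val_gminus// irrational_gt0//; lra.
Qed.

Lemma gsub_grat (r s : R) : 0 <= r <= 1 -> 0 <= s <= 1 -> s <= r ->
  gsub (grat r) (grat s) = grat (r - s).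
Proof.
move=> r01 s01 sr; apply/val_inj.
rewrite gsubE; last exact: grat_le.
rewrite !val_grat//; last by lra.
case: (asboolP (rational r)) => rQ; case: (asboolP (rational s)) => sQ //.
  by have /asboolP -> := rationalB rQ sQ.
case: asboolP => // rsQ; exfalso; apply: rQ.
by rewrite -(subrK s r); exact: rationalD.
Qed.

Lemma iota_sharp_subproof (m : I_measure) : is_Gamma_measure (@iota_map R \o m).
Proof.
case: (I_measureP m) => mmon m0 m1 m3.
have m01 a : 0 <= (m a)%:num <= 1 by apply/andP; split.
have imon a b : (a <= b)%O -> (iota_map (m a) <= iota_map (m b))%O.
  by move=> /mmon ab; exact: grat_le.
split => /=.
- exact: imon.
- by apply: greal_eq0; rewrite greal_iota.
- apply/val_inj; rewrite /iota_map m1 /=.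
  by have /asboolP -> := @rational1 R; rewrite val_gcirc ?lexx ?ler01//; exact: rational1.
- move=> a b.
  have hI : (a `&` b <= a)%O by exact: leIl.
  have hU : (b <= a `|` b)%O by exact: leUr.
  rewrite [gsub (iota_map (m (a `|` b)%O)) _]gsub_grat//; last exact: mmon.
  rewrite [gsub (iota_map (m a)) _]gsub_grat//; last exact: mmon.
  have mE : (m a)%:num - (m (a `&` b)%O)%:num = (m (a `|` b)%O)%:num - (m b)%:num.
    by have := m3 a b; lra.
  split; apply: (le_trans (le_grat _)); rewrite greal_gsim ?greal_iota ?imon//.
    by rewrite mE.
  by rewrite -mE.
Qed.

Definition iota_sharp (m : I_measure) : Gamma_measure :=
  GammaMeasure (iota_sharp_subproof m).

End Measures.

(* v_1, v_2, ... are represented by the natural numbers 0, 1, ... *)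
Record signature := Signature { relsym : Type; arity : relsym -> nat }.

Section FirstOrderLogic.
Variable sigma : signature.

Inductive formula :=
  | FFalse
  | FEq of nat & nat
  | FRel (r : relsym sigma) of (arity r).-tuple nat
  | FNot of formula
  | FAnd of formula & formula
  | FOr of formula & formula
  | FEx of nat & formula
  | FAll of nat & formula.

HB.instance Definition _ := gen_eqMixin formula.
HB.instance Definition _ := gen_choiceMixin formula.

Fixpoint free_vars (phi : formula) : seq nat :=
  match phi with
  | FFalse => [::]
  | FEq i j => [:: i; j]
  | FRel _ t => t
  | FNot phi => free_vars phi
  | FAnd phi psi | FOr phi psi => free_vars phi ++ free_vars psi
  | FEx i phi | FAll i phi => [seq j <- free_vars phi | j != i]
  end.

Record structure := Structure {
  carrier :> Type;
  rel_of : forall r : relsym sigma, (arity r).-tuple carrier -> Prop;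
  carrier_nonempty : inhabited carrier }.

Fixpoint sat (B : structure) (v : nat -> B) (phi : formula) : Prop :=
  match phi with
  | FFalse => False
  | FEq i j => v i = v j
  | FRel r t => rel_of (map_tuple v t)
  | FNot phi => ~ sat v phi
  | FAnd phi psi => sat v phi /\ sat v psi
  | FOr phi psi => sat v phi \/ sat v psi
  | FEx i phi => exists b : B, sat [eta v with i |-> b] phi
  | FAll i phi => forall b : B, sat [eta v with i |-> b] phi
  end.

Definition logeq : rel formula := fun phi psi =>
  `[< forall (B : structure) (v : nat -> B), sat v phi <-> sat v psi >].

Fact logeq_refl : reflexive logeq.
Proof. by move=> phi; apply/asboolP. Qed.

Fact logeq_sym : symmetric logeq.
Proof.
by move=> phi psi; apply/asboolP/asboolP => h B v; split => /(h B v).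
Qed.

Fact logeq_trans : transitive logeq.
Proof.
move=> psi phi chi /asboolP h1 /asboolP h2; apply/asboolP => B v.
by rewrite h1 h2.
Qed.

Canonical logeq_equiv := EquivRel logeq logeq_refl logeq_sym logeq_trans.

Definition FO := {eq_quot logeq}.
HB.instance Definition _ := Choice.on FO.
HB.instance Definition _ := EqQuotient.on FO.

Definition satq (B : structure) (v : nat -> B) (x : FO) : Prop :=
  sat v (repr x).

Lemma satq_pi (B : structure) (v : nat -> B) (phi : formula) :
  satq v (\pi_FO phi) <-> sat v phi.
Proof.
rewrite /satq; have /eqmodP/asboolP h : (repr (\pi_FO phi) = phi %[mod FO]).
  by rewrite reprK.
exact: h.
Qed.

Lemma FO_ext (x y : FO) :
  (forall (B : structure) (v : nat -> B), satq v x <-> satq v y) -> x = y.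
Proof.
move=> xy; rewrite -[x]reprK -[y]reprK; apply/eqmodP/asboolP; exact: xy.
Qed.

Definition FO_meet (x y : FO) : FO := (\pi_FO (FAnd (repr x) (repr y))).
Definition FO_join (x y : FO) : FO := (\pi_FO (FOr (repr x) (repr y))).
Definition FO_compl (x : FO) : FO := (\pi_FO (FNot (repr x))).
Definition FO_bot : FO := (\pi_FO FFalse).
Definition FO_top : FO := (\pi_FO (FNot FFalse)).
Definition FO_le (x y : FO) : bool :=
  `[< forall (B : structure) (v : nat -> B), satq v x -> satq v y >].
Definition FO_lt (x y : FO) : bool := (y != x) && FO_le x y.

Lemma satq_meet B v x y : @satq B v (FO_meet x y) <-> satq v x /\ satq v y.
Proof. exact: satq_pi. Qed.
Lemma satq_join B v x y : @satq B v (FO_join x y) <-> satq v x \/ satq v y.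
Proof. exact: satq_pi. Qed.
Lemma satq_compl B v x : @satq B v (FO_compl x) <-> ~ satq v x.
Proof. exact: satq_pi. Qed.
Lemma satq_bot B v : @satq B v FO_bot <-> False.
Proof. exact: satq_pi. Qed.
Lemma satq_top B v : @satq B v FO_top <-> True.
Proof. by rewrite satq_pi /=; tauto. Qed.

Definition satqE :=
  (satq_meet, satq_join, satq_compl, satq_bot, satq_top).

Fact FO_le_def x y : FO_le x y = (FO_meet x y == x).
Proof.
apply/asboolP/eqP => [h|<- B v]; last by rewrite satq_meet; tauto.
apply: FO_ext => B v; rewrite satq_meet; move: (h B v); tauto.
Qed.
Fact FO_meetC : commutative FO_meet.
Proof. by move=> x y; apply: FO_ext => B v; rewrite !satqE; tauto. Qed.
Fact FO_joinC : commutative FO_join.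
Proof. by move=> x y; apply: FO_ext => B v; rewrite !satqE; tauto. Qed.
Fact FO_meetA : associative FO_meet.
Proof. by move=> x y z; apply: FO_ext => B v; rewrite !satqE; tauto. Qed.
Fact FO_joinA : associative FO_join.
Proof. by move=> x y z; apply: FO_ext => B v; rewrite !satqE; tauto. Qed.
Fact FO_joinKI y x : FO_meet x (FO_join x y) = x.
Proof. by apply: FO_ext => B v; rewrite !satqE; tauto. Qed.
Fact FO_meetKU y x : FO_join x (FO_meet x y) = x.
Proof. by apply: FO_ext => B v; rewrite !satqE; tauto. Qed.
Fact FO_meetUl : left_distributive FO_meet FO_join.
Proof. by move=> x y z; apply: FO_ext => B v; rewrite !satqE; tauto. Qed.
Fact FO_meetxx : idempotent_op FO_meet.
Proof. by move=> x; apply: FO_ext => B v; rewrite !satqE; tauto. Qed.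

Fact FO_display : Order.disp_t. Proof. exact: Order.Disp tt tt. Qed.

HB.instance Definition _ := @Order.isMeetJoinDistrLattice.Build FO_display FO
  FO_le FO_lt FO_meet FO_join FO_le_def (fun _ _ => erefl) FO_meetC FO_joinC
  FO_meetA FO_joinA FO_joinKI FO_meetKU FO_meetUl FO_meetxx.

Fact FO_le0x (x : FO) : (FO_bot <= x)%O.
Proof. by apply/asboolP => B v; rewrite satqE. Qed.
Fact FO_lex1 (x : FO) : (x <= FO_top)%O.
Proof. by apply/asboolP => B v; rewrite satqE. Qed.
HB.instance Definition _ := Order.hasBottom.Build FO_display FO FO_le0x.
HB.instance Definition _ := Order.hasTop.Build FO_display FO FO_lex1.

Fact FO_joinxC (x : FO) : (x `|` FO_compl x = \top)%O.
Proof.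
apply: FO_ext => B v; rewrite !satqE; have [] := pselect (satq v x); tauto.
Qed.
Fact FO_meetxC (x : FO) : (x `&` FO_compl x = \bot)%O.
Proof. by apply: FO_ext => B v; rewrite !satqE; tauto. Qed.
HB.instance Definition _ :=
  Order.TBDistrLattice_hasComplement.Build FO_display FO FO_joinxC FO_meetxC.

(* The classes of the formulas with free variables among v_1, ..., v_n. *)
Definition in_FO_n (n : nat) (x : FO) : Prop :=
  exists2 phi : formula,
    all (fun i => i < n)%N (free_vars phi) & x = (\pi_FO phi).

Record FO_n (n : nat) := MkFO_n {
  FO_of :> FO;
  FO_ofP : in_FO_n n FO_of }.

Record pointed_structure (n : nat) := Pointed {
  underlying :> structure;
  assignment : 'I_n -> underlying }.

Arguments assignment {n} P i : rename.

(* Satisfaction in (B, beta) of a formula whose free variables are interpreted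
   by beta; the values of v at the other variables are irrelevant. *)
Definition models (n : nat) (P : pointed_structure n) (x : FO_n n) : Prop :=
  exists2 v : nat -> P, forall i : 'I_n, v i = assignment P i & satq v x.

HB.instance Definition _ n := gen_eqMixin (pointed_structure n).
HB.instance Definition _ n := gen_choiceMixin (pointed_structure n).

Definition elemeq (n : nat) : rel (pointed_structure n) := fun P Q =>
  `[< forall x : FO_n n, models P x <-> models Q x >].

Fact elemeq_refl n : reflexive (@elemeq n).
Proof. by move=> P; apply/asboolP. Qed.

Fact elemeq_sym n : symmetric (@elemeq n).
Proof. by move=> P Q; apply/asboolP/asboolP => h x; split => /(h x). Qed.

Fact elemeq_trans n : transitive (@elemeq n).
Proof.
move=> Q P S /asboolP h1 /asboolP h2; apply/asboolP => x; by rewrite h1 h2.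
Qed.

Canonical elemeq_equiv n :=
  EquivRel (@elemeq n) (@elemeq_refl n) (@elemeq_sym n) (@elemeq_trans n).

Definition Typ (n : nat) := {eq_quot (@elemeq n)}.
HB.instance Definition _ n := Choice.on (Typ n).
HB.instance Definition _ n := EqQuotient.on (Typ n).

(* The set [[x]]_n. *)
Definition extension (n : nat) (x : FO_n n) : set (Typ n) :=
  [set E | exists2 P : pointed_structure n, E = (\pi_(Typ n) P) & models P x].

Record fin_structure := FinStructure {
  fin_str :> structure;
  fin_strP : finite_set [set: fin_str] }.

(* The carrier of A, with its (classical) finType structure. *)
Definition fin_carrier (A : fin_structure) : predArgType := A.

HB.instance Definition _ A := gen_eqMixin (fin_carrier A).
HB.instance Definition _ A := gen_choiceMixin (fin_carrier A).

Lemma fin_enum_exists A :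
  exists s : seq (fin_carrier A), [set: fin_carrier A] = [set` s].
Proof. exact/finite_seqP/fin_strP. Qed.

Definition fin_enum A : seq (fin_carrier A) :=
  undup (sval (cid (fin_enum_exists A))).

Lemma mem_fin_enum A (a : fin_carrier A) : a \in fin_enum A.
Proof.
rewrite /fin_enum mem_undup; case: cid => s /= sE.
by have : [set` s] a by rewrite -sE.
Qed.

Lemma fin_enumK A : pcancel (index^~ (fin_enum A)) (onth (fin_enum A)).
Proof.
by move=> a; rewrite onthE (nth_map a) ?index_mem ?nth_index ?mem_fin_enum.
Qed.

HB.instance Definition _ A : isCountable (fin_carrier A) :=
  PCanIsCountable (@fin_enumK A).

Lemma fin_enumP A : Finite.axiom (fin_enum A).
Proof. by move=> a; rewrite count_uniq_mem ?undup_uniq// mem_fin_enum. Qed.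

HB.instance Definition _ A := isFinite.Build (fin_carrier A) (@fin_enumP A).

HB.instance Definition _ := gen_eqMixin fin_structure.
HB.instance Definition _ := gen_choiceMixin fin_structure.

Definition isomorphic : rel fin_structure := fun A B =>
  `[< exists2 f : A -> B, bijective f &
      forall (r : relsym sigma) (t : (arity r).-tuple A),
        rel_of t <-> rel_of (map_tuple f t) >].

Fact isomorphic_refl : reflexive isomorphic.
Proof.
move=> A; apply/asboolP; exists id; first by exists id.
by move=> r t; rewrite (_ : map_tuple id t = t)//; apply/val_inj; rewrite /= map_id.
Qed.

Lemma isomorphic_symW A B : isomorphic A B -> isomorphic B A.
Proof.
move=> /asboolP[f [g fK gK] fP]; apply/asboolP; exists g; first by exists f.
move=> r t; rewrite fP (_ : map_tuple f _ = t)//; apply/val_inj => /=.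
by rewrite -map_comp (eq_map gK) map_id.
Qed.

Fact isomorphic_sym : symmetric isomorphic.
Proof. by move=> A B; apply/idP/idP => /isomorphic_symW. Qed.

Fact isomorphic_trans : transitive isomorphic.
Proof.
move=> B A C /asboolP[f fb fP] /asboolP[g gb gP]; apply/asboolP.
exists (g \o f); first exact: bij_comp.
move=> r t; rewrite fP gP; rewrite (_ : map_tuple (g \o f) t = map_tuple g (map_tuple f t))//.
by apply/val_inj; rewrite /= -map_comp.
Qed.

Canonical isomorphic_equiv :=
  EquivRel isomorphic isomorphic_refl isomorphic_sym isomorphic_trans.

Definition Fin := {eq_quot isomorphic}.
HB.instance Definition _ := Choice.on Fin.
HB.instance Definition _ := EqQuotient.on Fin.

Definition point (A : fin_structure) (n : nat)
    (alpha : {ffun 'I_n -> fin_carrier A}) : pointed_structure n :=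
  @Pointed n A alpha.

End FirstOrderLogic.

Section StonePairing.
Variables (R : realType) (sigma : signature).
Implicit Types (A : fin_structure sigma) (n : nat).

(* The function f_n^A. *)
Definition typ_weight A n (E : Typ sigma n) : Gamma R :=
  \big[@gadd R/g0]_(alpha : {ffun 'I_n -> fin_carrier A}
      | (\pi_(Typ sigma n) (point alpha)) == E)
    gcirc (1 / #|fin_carrier A|%:R ^+ n).

(* The measure mu_n^A: \big[_/_]_(E \in _) only ranges over the E in the given
   set with typ_weight A E <> g0. *)
Definition stone_Gamma_n A n (x : FO_n sigma n) : Gamma R :=
  \big[@gadd R/g0]_(E \in extension x) typ_weight A E.

Definition stone_I_n A n (x : FO_n sigma n) : R :=
  #|[set alpha : {ffun 'I_n -> fin_carrier A} | `[< models (point alpha) x >]]%SET|%:R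
  / #|fin_carrier A|%:R ^+ n.

End StonePairing.

Section FreeVariables.
Variable sigma : signature.
Implicit Types (phi psi : formula sigma) (x y : FO sigma).

Lemma sat_free_vars (B : structure sigma) phi (v w : nat -> B) :
  {in free_vars phi, v =1 w} -> sat v phi <-> sat w phi.
Proof.
have upd (u u' : nat -> B) i b s : {in [seq j <- s | j != i], u =1 u'} ->
    {in s, [eta u with i |-> b] =1 [eta u' with i |-> b]}.
  move=> uu' j js /=; case: ifPn => // ji; apply: uu'.
  by rewrite mem_filter ji.
elim: phi v w => //=.
- by move=> i j v w vw; rewrite !vw ?inE ?eqxx ?orbT.
- move=> r t v w vw; rewrite (_ : map_tuple v t = map_tuple w t)//.
  by apply/val_inj/eq_in_map.
- by move=> phi IH v w /IH; tauto.
- move=> phi IH1 psi IH2 v w vw.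
  have h1 : sat v phi <-> sat w phi by apply: IH1 => i h; apply: vw; rewrite mem_cat h.
  have h2 : sat v psi <-> sat w psi.
    by apply: IH2 => i h; apply: vw; rewrite mem_cat h orbT.
  by tauto.
- move=> phi IH1 psi IH2 v w vw.
  have h1 : sat v phi <-> sat w phi by apply: IH1 => i h; apply: vw; rewrite mem_cat h.
  have h2 : sat v psi <-> sat w psi.
    by apply: IH2 => i h; apply: vw; rewrite mem_cat h orbT.
  by tauto.
- move=> i phi IH v w vw; split=> -[b h]; exists b; move: h; apply IH;
    by apply: upd => // j /vw.
- move=> i phi IH v w vw; split=> h b; move: (h b); apply IH;
    by apply: upd => // j /vw.
Qed.

Lemma in_FO_n_leq n m x : (n <= m)%N -> in_FO_n n x -> in_FO_n m x.
Proof.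
move=> nm [phi /allP phin ->]; exists phi => //; apply/allP => i /phin ni.
exact: leq_trans nm.
Qed.

Lemma in_FO_n_ex x : exists n, in_FO_n n x.
Proof.
exists (\max_(i <- free_vars (repr x)) i).+1, (repr x); last by rewrite reprK.
by apply/allP => i ix; rewrite ltnS; exact: leq_bigmax_seq.
Qed.

Lemma in_FO_n_meet n x y : in_FO_n n x -> in_FO_n n y -> in_FO_n n (x `&` y)%O.
Proof.
move=> [phi pn ->] [psi qn ->]; exists (FAnd phi psi); first by rewrite /= all_cat pn.
by apply: FO_ext => B v; rewrite satqE !satq_pi.
Qed.

Lemma in_FO_n_join n x y : in_FO_n n x -> in_FO_n n y -> in_FO_n n (x `|` y)%O.
Proof.
move=> [phi pn ->] [psi qn ->]; exists (FOr phi psi); first by rewrite /= all_cat pn.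
by apply: FO_ext => B v; rewrite satqE !satq_pi.
Qed.

Lemma in_FO_n_bot n : in_FO_n n (\bot%O : FO sigma).
Proof. by exists (FFalse sigma). Qed.

Lemma in_FO_n_top n : in_FO_n n (\top%O : FO sigma).
Proof. by exists (FNot (FFalse sigma)). Qed.

Lemma satq_FO_n n (x : FO_n sigma n) (B : structure sigma) (v w : nat -> B) :
  (forall i : 'I_n, v i = w i) -> satq v x <-> satq w x.
Proof.
move=> vw; case: (FO_ofP x) => phi /allP phin ->; rewrite !satq_pi.
by apply: sat_free_vars => i /phin ni; exact: (vw (Ordinal ni)).
Qed.

Lemma assignment_ext n (P : pointed_structure sigma n) :
  exists v : nat -> P, forall i : 'I_n, v i = assignment P i.
Proof.
case: (carrier_nonempty P) => b.
exists (fun j => if insub j is Some i then assignment P i else b) => i.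
by rewrite valK.
Qed.

Lemma modelsE n (P : pointed_structure sigma n) (x : FO_n sigma n) (v : nat -> P) :
  (forall i : 'I_n, v i = assignment P i) -> models P x <-> satq v x.
Proof.
move=> vP; split=> [[w wP]|vx]; last by exists v.
by apply: (iffLR (satq_FO_n x _)) => i; rewrite vP wP.
Qed.

End FreeVariables.

Section Counting.
Variables (R : realType) (sigma : signature) (A : fin_structure sigma).
Local Notation T := (fin_carrier A).

Definition solutions n (x : FO_n sigma n) : {set {ffun 'I_n -> T}} :=
  [set alpha : {ffun 'I_n -> T} | `[< models (point alpha) x >]].

Lemma in_solutions n (x : FO_n sigma n) (alpha : {ffun 'I_n -> T}) (v : nat -> A) :
  (forall i : 'I_n, v i = alpha i) -> alpha \in solutions x <-> satq v x.
Proof.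
move=> vP; have h := @modelsE _ _ (point alpha) x v vP.
by rewrite inE; split => [/asboolP|] hx; [|apply/asboolP]; apply h.
Qed.

Lemma ffun_ext n (alpha : {ffun 'I_n -> T}) :
  exists v : nat -> A, forall i : 'I_n, v i = alpha i.
Proof. exact: (assignment_ext (point alpha)). Qed.

Lemma card_fin_gt0 : (0 < #|T|)%N.
Proof. by case: (carrier_nonempty A) => a; apply/card_gt0P; exists (a : T). Qed.

Lemma card_solutions_add n k (x : FO_n sigma n) (y : FO_n sigma (n + k)) :
  x = y :> FO sigma -> (#|solutions y| = #|solutions x| * #|T| ^ k)%N.
Proof.
move=> xy.
pose g (p : {ffun 'I_n -> T} * {ffun 'I_k -> T}) : {ffun 'I_(n + k) -> T} :=
  [ffun i => match fintype.split i with inl j => p.1 j | inr j => p.2 j end].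
have g1 p j : g p (lshift k j) = p.1 j by rewrite ffunE -[lshift k j]/(unsplit (inl j)) unsplitK.
have g2 p j : g p (rshift n j) = p.2 j by rewrite ffunE -[rshift n j]/(unsplit (inr j)) unsplitK.
have gI : injective g.
  move=> [a b] [a' b'] ab; congr pair; apply/ffunP => j.
    by have := g1 (a, b) j; rewrite ab g1.
  by have := g2 (a, b) j; rewrite ab g2.
have gS p : (g p \in solutions y) = (p.1 \in solutions x).
  have [v vP] := ffun_ext (g p).
  have vP1 (i : 'I_n) : v i = p.1 i by rewrite -g1 -vP.
  by apply/idP/idP => [/(in_solutions _ vP)|/(in_solutions _ vP1)] h;
    [apply/(in_solutions _ vP1)|apply/(in_solutions _ vP)]; [rewrite xy|rewrite -xy].
have -> : solutions y = g @: finset.setX (solutions x) finset.setT.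
  apply/setP => alpha; apply/idP/imsetP => [ay|[[p1 p2]]].
    pose p := ([ffun j => alpha (lshift k j)] : {ffun 'I_n -> T},
              [ffun j => alpha (rshift n j)] : {ffun 'I_k -> T}).
    have pE : alpha = g p.
      apply/ffunP => i; rewrite -[i](splitK) /unsplit; case: (fintype.split i) => j.
        by rewrite g1 ffunE.
      by rewrite g2 ffunE.
    by exists p => //; rewrite finset.in_setX finset.in_setT andbT -[X in X \in _]/(p.1) -gS -pE.
  by rewrite finset.in_setX => /andP[px _] ->; rewrite gS.
by rewrite card_imset// cardsX cardsT card_ffun card_ord.
Qed.

Lemma stone_I_nE n (x : FO_n sigma n) :
  stone_I_n R A x = #|solutions x|%:R / #|T|%:R ^+ n.
Proof. by []. Qed.

Lemma natT_neq0 n : (#|T|%:R ^+ n : R) != 0.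
Proof. by rewrite expf_neq0// pnatr_eq0 -lt0n card_fin_gt0. Qed.

Lemma natT_gt0 n : 0 < (#|T|%:R ^+ n : R).
Proof. by rewrite exprn_gt0// ltr0n card_fin_gt0. Qed.

Lemma stone_I_n_compat n m (x : FO_n sigma n) (y : FO_n sigma m) :
  x = y :> FO sigma -> stone_I_n R A x = stone_I_n R A y.
Proof.
wlog nm : n m x y / (n <= m)%N.
  move=> h xy; have [nm|/ltnW mn] := leqP n m; first exact: h.
  by apply/esym/h.
rewrite -(subnKC nm) in y *; move: (m - n)%N y => k y xy {nm}.
rewrite !stone_I_nE (card_solutions_add xy) natrM natrX exprD -mulf_div.
by rewrite divff ?mulr1// natT_neq0.
Qed.

Lemma stone_I_n_ge0 n (x : FO_n sigma n) : 0 <= stone_I_n R A x.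
Proof. by rewrite stone_I_nE divr_ge0// ltW// natT_gt0. Qed.

Lemma stone_I_n_le1 n (x : FO_n sigma n) : stone_I_n R A x <= 1.
Proof.
rewrite stone_I_nE ler_pdivrMr ?natT_gt0// mul1r -natrX ler_nat.
by rewrite (leq_trans (max_card _))// card_ffun card_ord.
Qed.

Definition FO_rank (x : FO sigma) : nat := sval (cid (in_FO_n_ex x)).
Definition to_FO_n (x : FO sigma) : FO_n sigma (FO_rank x) :=
  MkFO_n (svalP (cid (in_FO_n_ex x))).

Definition stone_I_fun (x : FO sigma) : {i01 R} :=
  Itv01 (stone_I_n_ge0 (to_FO_n x)) (stone_I_n_le1 (to_FO_n x)).

Lemma stone_I_funE n (x : FO_n sigma n) : (stone_I_fun x)%:num = stone_I_n R A x.
Proof. by rewrite /=; exact: stone_I_n_compat. Qed.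

Lemma common_FO_n (a b : FO sigma) : exists n (x y : FO_n sigma n),
  a = x /\ b = y.
Proof.
have [n an] := in_FO_n_ex a; have [m bm] := in_FO_n_ex b.
exists (maxn n m), (MkFO_n (in_FO_n_leq (leq_maxl n m) an)),
  (MkFO_n (in_FO_n_leq (leq_maxr n m) bm)).
by [].
Qed.

Lemma stone_I_measure : is_I_measure stone_I_fun.
Proof.
split.
- move=> a b; have [n [x [y [-> ->]]]] := common_FO_n a b => /asboolP xy.
  rewrite !stone_I_funE !stone_I_nE ler_pM2r ?invr_gt0 ?natT_gt0// ler_nat.
  apply/subset_leq_card/fintype.subsetP => alpha.
  have [v vP] := ffun_ext alpha.
  by move=> /(in_solutions _ vP) h; apply/(in_solutions _ vP)/xy.
- rewrite (@stone_I_funE 0 (MkFO_n (in_FO_n_bot sigma 0))) stone_I_nE.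
  rewrite (_ : solutions _ = finset.set0) ?cards0 ?mul0r//.
  apply/setP => alpha; rewrite !inE; apply/asboolP => -[v _].
  by rewrite satqE.
- rewrite (@stone_I_funE 0 (MkFO_n (in_FO_n_top sigma 0))) stone_I_nE.
  rewrite (_ : solutions _ = finset.setT).
    by rewrite cardsT card_ffun card_ord expn0 expr0 divr1.
  apply/setP => alpha; rewrite !inE; apply/asboolP.
  have [v vP] := ffun_ext alpha; exists v => //; by rewrite satqE.
- move=> a b; have [n [x [y [-> ->]]]] := common_FO_n a b.
  rewrite (stone_I_funE x) (stone_I_funE y).
  rewrite (@stone_I_funE n (MkFO_n (in_FO_n_join (FO_ofP x) (FO_ofP y)))).
  rewrite (@stone_I_funE n (MkFO_n (in_FO_n_meet (FO_ofP x) (FO_ofP y)))).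
  rewrite !stone_I_nE -!mulrDl -!natrD -cardsUI; congr (((_ + _)%N%:R : R) / _).
    congr #|pred_of_set _|; apply/setP => alpha; have [v vP] := ffun_ext alpha.
    rewrite finset.in_setU; apply/orP/idP => [h|].
      apply/(in_solutions _ vP); rewrite /= satqE.
      by case: h => /(in_solutions _ vP); tauto.
    by move=> /(in_solutions _ vP); rewrite /= satqE => -[] h; [left|right];
       apply/(in_solutions _ vP).
  congr #|pred_of_set _|; apply/setP => alpha; have [v vP] := ffun_ext alpha.
  rewrite finset.in_setI; apply/andP/idP => [[/(in_solutions _ vP) h1 /(in_solutions _ vP) h2]|].
    by apply/(in_solutions _ vP); rewrite /= satqE.
  by move=> /(in_solutions _ vP); rewrite /= satqE => -[h1 h2];
    split; apply/(in_solutions _ vP).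
Qed.

Lemma stone_I_exists : exists m : I_measure R (FO sigma),
  forall n (x : FO_n sigma n), (m (FO_of x))%:num = stone_I_n R A x.
Proof. by exists (IMeasure stone_I_measure) => n x; exact: stone_I_funE. Qed.

Lemma big_gcirc (c : R) (I : Type) (r : seq I) (P : pred I) :
  rational c -> 0 <= c -> (count P r)%:R * c <= 1 ->
  \big[@gadd R/g0]_(i <- r | P i) gcirc c = gcirc ((count P r)%:R * c).
Proof.
move=> cQ c0; elim: r => [|i r IH] /=.
  by move=> _; rewrite big_nil mul0r; apply/val_inj; rewrite val_gcirc ?lexx ?ler01//; exact: rational0.
have kQ k : rational (k%:R : R).
  by exists k%:R => //; rewrite ratr_nat.
have kcQ k : rational (k%:R * c).
  case: cQ => q _ <-; exists (k%:R * q) => //; by rewrite rmorphM /= ratr_nat.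
have kc0 k : 0 <= k%:R * c by rewrite mulr_ge0.
rewrite big_cons; case: ifPn => Pi; rewrite ?add0n//=.
rewrite natrD mulrDl mul1r => h.
have := kc0 (count P r) => h0.
rewrite IH; last by lra.
apply/val_inj; rewrite gaddE.
have c1 : 0 <= c <= 1 by lra.
have s1 : 0 <= (count P r)%:R * c <= 1 by lra.
rewrite !greal_gcirc// h !val_gcirc//=; first exact: rationalD.
by lra.
Qed.

Lemma extension_pi n (x : FO_n sigma n) (alpha : {ffun 'I_n -> T}) :
  ((\pi_(Typ sigma n) (point alpha)) \in extension x) = (alpha \in solutions x).
Proof.
rewrite !inE; apply/asboolP/asboolP => [[P /eqmodP/asboolP -> //]|h].
by exists (point alpha).
Qed.

Lemma stone_Gamma_nE n (x : FO_n sigma n) :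
  stone_Gamma_n R A x = gcirc (stone_I_n R A x).
Proof.
pose E (alpha : {ffun 'I_n -> T}) := \pi_(Typ sigma n) (point alpha).
pose s := undup [seq E alpha | alpha <- index_enum {ffun 'I_n -> T}].
have Es alpha : E alpha \in s.
  by rewrite mem_undup; apply/map_f; rewrite mem_index_enum.
pose r := [seq e <- s | e \in extension x].
have -> : stone_Gamma_n R A x =
    \big[@gadd R/g0]_(e <- r | e \in extension x) typ_weight R A e.
  apply: (@fsbigE _ _ (@gadd R)); first by rewrite filter_uniq// undup_uniq.
    by move=> e /=; rewrite mem_filter => /andP[+ _]; rewrite inE.
  move=> e ex; rewrite mem_filter => /nandP[/negP|es]; first by rewrite inE.
  apply: big_pred0 => alpha; apply/negP => /eqP ae.
  by move: es; rewrite -ae; apply/negP; rewrite negbK; exact: Es.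
rewrite big_filter_cond.
rewrite (eq_bigl (fun e => e \in extension x)); last by move=> e; rewrite andbb.
rewrite /typ_weight (exchange_big_dep xpredT)//=.
rewrite (eq_bigr (fun alpha : {ffun 'I_n -> T} =>
    if alpha \in solutions x then gcirc (1 / #|T|%:R ^+ n) else g0)); last first.
  move=> alpha _; rewrite -extension_pi; case: ifPn => ax.
    rewrite (eq_bigl (pred1 (E alpha))).
      by rewrite -big_filter filter_pred1_uniq ?undup_uniq// big_seq1.
    by move=> e /=; rewrite andbC eq_sym; case: eqP => // ->.
  rewrite big1_seq// => e /andP[/andP[ex /eqP ae] _].
  by move: ax; rewrite ae ex.
rewrite -big_mkcond big_gcirc ?divr_ge0 ?exprn_ge0//.
- by rewrite -sum1_count sum1_card mul1r.
- exists (1 / #|T|%:R ^+ n) => //.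
  by rewrite fmorph_div rmorph1 rmorphXn /= ratr_nat.
- rewrite -sum1_count sum1_card mul1r; exact: stone_I_n_le1.
Qed.

Lemma rational_stone_I_n n (x : FO_n sigma n) : rational (stone_I_n R A x).
Proof.
exists (#|solutions x|%:R / #|T|%:R ^+ n) => //.
by rewrite fmorph_div rmorphXn /= !ratr_nat.
Qed.

Lemma stone_Gamma_exists : exists mu : Gamma_measure R (FO sigma),
  forall n (x : FO_n sigma n), mu (FO_of x) = stone_Gamma_n R A x.
Proof.
exists (iota_sharp (IMeasure stone_I_measure)) => n x.
rewrite /= /iota_map stone_I_funE stone_Gamma_nE.
by have /asboolP -> := rational_stone_I_n x.
Qed.

End Counting.

Section Isomorphism.
Variables (R : realType) (sigma : signature).

Lemma sat_isomorphic (A B : structure sigma) (f : A -> B) :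
  bijective f ->
  (forall (r : relsym sigma) (t : (arity r).-tuple A),
     rel_of t <-> rel_of (map_tuple f t)) ->
  forall (phi : formula sigma) (v : nat -> A), sat v phi <-> sat (f \o v) phi.
Proof.
move=> fb fP; have [g fK gK] := fb.
have upd (v : nat -> A) i a :
    f \o [eta v with i |-> a] = [eta f \o v with i |-> f a].
  by apply/funext => j /=; case: ifP.
elim => //=.
- by move=> i j v; split=> [->//|/(bij_inj fb)].
- move=> r t v; rewrite fP (_ : map_tuple (f \o v) t = map_tuple f (map_tuple v t))//.
  by apply/val_inj; rewrite /= -map_comp.
- by move=> phi IH v; have := IH v; tauto.
- by move=> phi IH1 psi IH2 v; have := IH1 v; have := IH2 v; tauto.
- by move=> phi IH1 psi IH2 v; have := IH1 v; have := IH2 v; tauto.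
- move=> i phi IH v; split=> [[a /IH h]|[b h]].
    by exists (f a); rewrite -upd.
  by exists (g b); apply/IH; rewrite upd gK.
- move=> i phi IH v; split=> h a.
    by rewrite -(gK a) -upd; apply/IH.
  by apply/IH; rewrite upd.
Qed.

Lemma stone_I_n_isomorphic (A B : fin_structure sigma) n (x : FO_n sigma n) :
  isomorphic A B -> stone_I_n R A x = stone_I_n R B x.
Proof.
move=> /asboolP[f fb fP].
have fb' : bijective (f : fin_carrier A -> fin_carrier B) by [].
rewrite !stone_I_nE (bij_eq_card fb'); congr (_%:R / _).
pose g (alpha : {ffun 'I_n -> fin_carrier A}) : {ffun 'I_n -> fin_carrier B} :=
  [ffun i => f (alpha i)].
have [f' fK f'K] := fb'.
have gI : injective g.
  move=> a b ab; apply/ffunP => i; apply: (bij_inj fb').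
  by have := congr1 (fun h : {ffun _ -> _} => h i) ab; rewrite !ffunE.
have gS alpha : (g alpha \in solutions B x) = (alpha \in solutions A x).
  have [v vP] := ffun_ext alpha.
  have vP' (i : 'I_n) : (f \o v) i = g alpha i by rewrite ffunE -vP.
  have h : satq v x <-> satq (f \o v) x by exact: sat_isomorphic.
  by apply/idP/idP => [/(in_solutions _ vP')/h|/(in_solutions _ vP)/h] k;
    [apply/(in_solutions _ vP)|apply/(in_solutions _ vP')].
rewrite -(card_imset _ gI); congr #|pred_of_set _|.
apply/setP => beta; apply/imsetP/idP => [[alpha ax ->]|bx]; first by rewrite gS.
have bE : beta = g [ffun i => f' (beta i)].
  by apply/ffunP => i; rewrite !ffunE f'K.
by exists [ffun i => f' (beta i)] => //; rewrite -gS -bE.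
Qed.

End Isomorphism.

Section Pairings.
Variables (R : realType) (sigma : signature).

(* Every element of FO sigma lies in some FO_n, so that a function on FO sigma
   is determined by its restrictions to the FO_n. *)
Lemma stone_Gamma_unique (A : fin_structure sigma)
    (mu nu : Gamma_measure R (FO sigma)) :
  (forall n (x : FO_n sigma n), mu (FO_of x) = stone_Gamma_n R A x) ->
  (forall n (x : FO_n sigma n), nu (FO_of x) = stone_Gamma_n R A x) ->
  mu = nu.
Proof.
move=> muP nuP; apply: Gamma_measure_ext => x.
by have := muP _ (to_FO_n x); rewrite -nuP.
Qed.

Lemma stone_I_unique (A : fin_structure sigma)
    (m l : I_measure R (FO sigma)) :
  (forall n (x : FO_n sigma n), (m (FO_of x))%:num = stone_I_n R A x) ->
  (forall n (x : FO_n sigma n), (l (FO_of x))%:num = stone_I_n R A x) ->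
  m = l.
Proof.
move=> mP lP; apply: I_measure_ext => x; apply/val_inj.
by have := mP _ (to_FO_n x); rewrite -lP.
Qed.

Definition stone_Gamma_structure (A : fin_structure sigma) :
  Gamma_measure R (FO sigma) := sval (cid (stone_Gamma_exists R A)).

Definition stone_I_structure (A : fin_structure sigma) :
  I_measure R (FO sigma) := sval (cid (stone_I_exists R A)).

Lemma stone_Gamma_structureP (A : fin_structure sigma) n (x : FO_n sigma n) :
  stone_Gamma_structure A (FO_of x) = stone_Gamma_n R A x.
Proof. by rewrite /stone_Gamma_structure; case: cid => mu /= ->. Qed.

Lemma stone_I_structureP (A : fin_structure sigma) n (x : FO_n sigma n) :
  (stone_I_structure A (FO_of x))%:num = stone_I_n R A x.
Proof. by rewrite /stone_I_structure; case: cid => m /= ->. Qed.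

(* A class in Fin sigma is sent to the pairing of a representative; by
   stone_Gamma_pi and stone_I_pi the choice is immaterial. *)
Definition stone_Gamma (A : Fin sigma) : Gamma_measure R (FO sigma) :=
  stone_Gamma_structure (repr A).

Definition stone_I (A : Fin sigma) : I_measure R (FO sigma) :=
  stone_I_structure (repr A).

Lemma repr_isomorphic (A : fin_structure sigma) :
  isomorphic (repr (\pi_(Fin sigma) A)) A.
Proof.
have /eqmodP // : (repr (\pi_(Fin sigma) A) = A %[mod Fin sigma]).
by rewrite reprK.
Qed.

Lemma stone_Gamma_pi (A : fin_structure sigma) :
  stone_Gamma (\pi_(Fin sigma) A) = stone_Gamma_structure A.
Proof.
apply: (@stone_Gamma_unique A) => n x; last exact: stone_Gamma_structureP.
rewrite /stone_Gamma stone_Gamma_structureP !stone_Gamma_nE.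
by rewrite (stone_I_n_isomorphic _ _ (repr_isomorphic A)).
Qed.

Lemma stone_I_pi (A : fin_structure sigma) :
  stone_I (\pi_(Fin sigma) A) = stone_I_structure A.
Proof.
apply: (@stone_I_unique A) => n x; last exact: stone_I_structureP.
rewrite /stone_I stone_I_structureP.
exact: (stone_I_n_isomorphic _ _ (repr_isomorphic A)).
Qed.

End Pairings.

(* Main.v *)
Require Import Defs.
From mathcomp Require Import interval_inference.
From mathcomp Require Import all_boot all_order all_algebra.
From mathcomp Require Import all_classical all_reals.

(* The [Gamma]-valued pairing of a formula with [A] is a finite sum of equal
   rational weights [1/|A|^n], all of the form [q°]; such sums are computed as
   in the rationals, so the pairing is [q°] for the classical pairing [q], which
   [gamma_map] and [iota_map] exchange with [q]. *)

Theorem theorem5p5 (R : realType) (sigma : signature) (A : Fin sigma) :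
  gamma_sharp (stone_Gamma R A) = stone_I R A /\
  iota_sharp (stone_I R A) = stone_Gamma R A.
Proof.
have GE x : stone_Gamma R A x = iota_map (stone_I R A x).
  (* Both pairings are specified only on the levels [FO_n], so [x] is placed in one of them by
     [to_FO_n]. *)
  rewrite /iota_map (stone_I_structureP R (repr A) (to_FO_n x)).
  (* A number of solutions divided by [|A|^n] is rational, which selects the [gcirc] branch of
     [iota_map]. *)
  have /asboolP -> := rational_stone_I_n R (repr A) (to_FO_n x).
  by rewrite -stone_Gamma_nE -stone_Gamma_structureP.
split; last by apply: Gamma_measure_ext => x; rewrite GE.
(* By [GE] this reduces to [gamma_map] being a left inverse of [iota_map], which holds on all of
   [[0,1]]. *)
by apply: I_measure_ext => x; apply: val_inj; rewrite /= GE greal_iota.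
Qed.
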